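(* With the same initial configuration $\mathbb{C}$, Property 6 subsumes Property 3 as a special case, where Property 3 and Property 6 are the two statements about $\mathbb{C}$ given in the context.
   Context: Setting (block relocation problem). There are $S$ stacks and $B$ blocks labelled by $\{1,\dots,B\}$; a smaller label means a higher priority (earlier retrieval). The initial configuration $\mathbb{C}$ places every block in exactly one stack, each stack being a vertical sequence of blocks. Blocks are to be retrieved in the order $1,\dots,B$, a block being retrievable only when it is topmost in its stack; a relocation moves the topmost block of a stack to the top of another stack. The target block is the block of highest priority (block $1$). It is assumed that no block is directly retrievable in $\mathbb{C}$ (block $1$ is not topmost). A block is badly placed (BP) if some block below it in the same stack has a smaller label; otherwise it is well placed (WP). A BG move is a relocation of a BP block after which it is WP; every other relocation is a non-BG move. The priority of a stack is the highest priority (smallest label) of a block in it, and $+\infty$ (the lowest priority) if it is empty. The top $k$-th layer consists of the $k$-th block from the top of each stack (defined when every stack has at least $k$ blocks); the top $k$ layers consist of all blocks of the top $1$st, ..., $k$-th layers. Property 3: at least one non-BG move has to be implemented on a block in each of the top $k$ layers, if (1) the target block is not in the top $k$ layers, and (2) the highest priority of the BP blocks in the top $k$ layers is lower than the lowest priority of all stacks after removing the top $k-1$ layers. A virtual layer is formed by picking one block from each of the $S$ stacks. A virtual layer satisfies P5 if (1) there exists a block piled below the virtual layer whose priority is higher than the highest priority of the blocks in the virtual layer, and (2) the highest priority of the BP blocks in the virtual layer is lower than the lowest priority of all stacks after removing the blocks above the virtual layer. Property 6: given $k$ non-overlapping virtual layers, each of which satisfies P5, at least $k$ non-BG moves will be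 implemented on blocks of those virtual layers. *)

(* Defs.v *)
From HB Require Import structures.
From mathcomp Require Import all_boot all_order all_algebra.
From mathcomp Require Import constructive_ereal.
Set Implicit Arguments.
Unset Strict Implicit.
Unset Printing Implicit Defensive.

Section BlockRelocation.
Variable S : nat.

(* Each stack is listed from top to bottom; a block is identified with its label. *)
Definition config := 'I_S -> seq nat.

Definition is_config (B : nat) (C : config) : bool :=
  perm_eq (flatten (codom C)) (iota 1 B).

Definition directly_retrievable (C : config) : bool :=
  [exists s, ohead (C s) == Some 1].

Definition below (b : nat) (st : seq nat) : seq nat := drop (index b st).+1 st.

Definition badly_placed (C : config) (b : nat) : bool :=
  [exists s, (b \in C s) && has (fun c => c < b) (below b (C s))].

Definition well_placed (C : config) (b : nat) : bool := ~~ badly_placed C b.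

Inductive move := Retrieve of 'I_S | Relocate of 'I_S & 'I_S.

Definition pop (C : config) (s : 'I_S) : config :=
  fun r => if r == s then behead (C s) else C r.

Definition push (C : config) (b : nat) (t : 'I_S) : config :=
  fun r => if r == t then b :: C t else C r.

(* [n] is the label of the next block to be retrieved. Stacks have unbounded
   height, any topmost block may be relocated, and a retrieval may be
   postponed. *)
Fixpoint solves_from (B n : nat) (C : config) (ms : seq move) : bool :=
  match ms with
  | [::] => n == B.+1
  | Retrieve s :: ms' =>
      (ohead (C s) == Some n) && solves_from B n.+1 (pop C s) ms'
  | Relocate s t :: ms' =>
      if C s is b :: _ then
        (s != t) && solves_from B n (push (pop C s) b t) ms'
      else false
  end.

Definition solution (B : nat) (C : config) (ms : seq move) : bool :=
  solves_from B 1 C ms.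

(* The blocks on which the successive non-BG moves of [ms] are implemented, with
   one occurrence for each such move. *)
Fixpoint nonBG_moves (C : config) (ms : seq move) : seq nat :=
  match ms with
  | [::] => [::]
  | Retrieve s :: ms' => nonBG_moves (pop C s) ms'
  | Relocate s t :: ms' =>
      if C s is b :: _ then
        let C' := push (pop C s) b t in
        let BG := badly_placed C b && well_placed C' b in
        if BG then nonBG_moves C' ms' else b :: nonBG_moves C' ms'
      else [::]
  end.

(* Priorities are labels extended with +oo, so a higher priority is a smaller
   value: the highest priority is a minimum, the lowest one a maximum. *)
Definition prio (b : nat) : \bar int := (Posz b)%:E.

Definition stack_prio (st : seq nat) : \bar int :=
  \big[Order.min/+oo%E]_(b <- st) prio b.

Definition lowest_stack_prio (C : config) : \bar int :=
  \big[Order.max/-oo%E]_(s < S) stack_prio (C s).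

(* Meaningful when every stack has at least [i >= 1] blocks. *)
Definition top_layer (C : config) (i : nat) : 'I_S -> nat :=
  fun s => nth 0 (C s) i.-1.

Definition highest_BP_prio_top (C : config) (k : nat) : \bar int :=
  \big[Order.min/+oo%E]_(s < S)
    \big[Order.min/+oo%E]_(b <- take k (C s) | badly_placed C b) prio b.

Definition top_layers_condition (C : config) (k : nat) : Prop :=
  [/\ 0 < k,
      forall s, k <= size (C s),
      forall s, 1 \notin take k (C s)
    & (lowest_stack_prio (fun s => drop k.-1 (C s))
         < highest_BP_prio_top C k)%E].

Definition property3 (B : nat) (C : config) : Prop :=
  forall k : nat, top_layers_condition C k ->
  forall ms : seq move, solution B C ms ->
  forall i : nat, 1 <= i <= k ->
  exists s : 'I_S, top_layer C i s \in nonBG_moves C ms.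

Definition virtual_layer (C : config) (L : 'I_S -> nat) : Prop :=
  forall s, L s \in C s.

Definition highest_prio (L : 'I_S -> nat) : \bar int :=
  \big[Order.min/+oo%E]_(s < S) prio (L s).

Definition highest_BP_prio (C : config) (L : 'I_S -> nat) : \bar int :=
  \big[Order.min/+oo%E]_(s < S | badly_placed C (L s)) prio (L s).

Definition remove_above (C : config) (L : 'I_S -> nat) : config :=
  fun s => drop (index (L s) (C s)) (C s).

Definition P5 (C : config) (L : 'I_S -> nat) : Prop :=
  (exists s, exists2 c, c \in below (L s) (C s) & (prio c < highest_prio L)%E)
  /\ (lowest_stack_prio (remove_above C L) < highest_BP_prio C L)%E.

Definition non_overlapping (k : nat) (L : 'I_k -> 'I_S -> nat) : Prop :=
  forall i j : 'I_k, i != j -> forall s t : 'I_S, L i s != L j t.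

Definition property6_condition (C : config) (k : nat)
    (L : 'I_k -> 'I_S -> nat) : Prop :=
  [/\ forall i, virtual_layer C (L i),
      non_overlapping L
    & forall i, P5 C (L i)].

Definition property6 (B : nat) (C : config) : Prop :=
  forall (k : nat) (L : 'I_k -> 'I_S -> nat), property6_condition C L ->
  forall ms : seq move, solution B C ms ->
  k <= count (fun b => [exists i, exists s, b == L i s]) (nonBG_moves C ms).

End BlockRelocation.

(* Main.v *)
(** If block 1 lies below the top [k] layers, then it lies below each of these
    layers, which gives the first half of P5. For the second half, going from the
    top [k] layers to the single [i]-th layer keeps only some of the BP blocks
    and removes fewer blocks from above: the highest BP priority can only become
    lower and every stack priority higher. Property 3 for the [i]-th layer is
    then Property 6 for the one-element family consisting of that layer. *)
Require Import Defs.
From HB Require Import structures.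
From mathcomp Require Import all_boot all_order all_algebra.
From mathcomp Require Import constructive_ereal.
Set Implicit Arguments.
Unset Strict Implicit.
Unset Printing Implicit Defensive.
Import Order.TTheory.

Section Configurations.
Variables (S B : nat) (C : config S).
Hypothesis C_config : is_config B C.

Lemma mem_config b : (0 < b <= B) = [exists s, b \in C s].
Proof.
have := perm_mem C_config b; rewrite mem_iota add1n ltnS => <-.
apply/flattenP/existsP => [[st /codomP[s ->] bs]|[s bs]]; first by exists s.
by exists (C s); rewrite ?codom_f.
Qed.

Lemma sum_count_le1 b : \sum_(s < S) count_mem b (C s) <= 1.
Proof.
have -> : \sum_(s < S) count_mem b (C s) = count_mem b (flatten (codom C)).
  by rewrite count_flatten sumnE big_map /codom /image_mem big_map big_enum.
by rewrite (permP C_config) count_uniq_mem ?iota_uniq ?leq_b1.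
Qed.

Lemma uniq_stack s : uniq (C s).
Proof.
apply: count_mem_uniq => b; apply/eqP; rewrite eqn_leq; apply/andP; split.
  have := sum_count_le1 b; rewrite (bigD1 s) //= => le1.
  case: (boolP (b \in C s)) => [_|/count_memPn -> //].
  exact: leq_trans (leq_addr _ _) le1.
by case: (boolP (b \in C s)); rewrite -?has_pred1 ?has_count.
Qed.

Lemma stack_inj b s t : b \in C s -> b \in C t -> s = t.
Proof.
move=> bs bt; apply/eqP; apply: contraTT (sum_count_le1 b) => st.
rewrite (bigD1 s) //= (bigD1 t) //=; last by rewrite eq_sym.
rewrite -ltnNge addnA.
move: bs bt; rewrite -!has_pred1 !has_count => bs bt.
exact: leq_trans (leq_add bs bt) (leq_addr _ _).
Qed.

Lemma top_layer_mem i s : i < size (C s) -> top_layer C i.+1 s \in C s.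
Proof. exact: mem_nth. Qed.

Lemma index_top_layer i s :
  i < size (C s) -> index (top_layer C i.+1 s) (C s) = i.
Proof. by move=> lt_i; rewrite index_uniq ?uniq_stack. Qed.

Lemma top_layer_neq i j s t : i < size (C s) -> j < size (C t) -> i != j ->
  top_layer C i.+1 s != top_layer C j.+1 t.
Proof.
move=> lt_i lt_j; apply: contraNneq => eq_b.
have st : s = t.
  apply: stack_inj (top_layer_mem lt_i) _; rewrite eq_b; exact: top_layer_mem.
by subst t; rewrite -(index_top_layer lt_i) eq_b index_top_layer.
Qed.

Lemma lowest_stack_prio_drop m n : m <= n ->
  (lowest_stack_prio (fun s => drop m (C s))
     <= lowest_stack_prio (fun s => drop n (C s)))%E.
Proof.
move=> le_mn; apply: le_bigmax2 => s _; apply: sub_bigmin_seq => b.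
by rewrite -(subnK le_mn) -drop_drop; apply: mem_drop.
Qed.

Lemma highest_BP_prio_layer k i : i < k -> (forall s, k <= size (C s)) ->
  (highest_BP_prio_top C k <= highest_BP_prio C (top_layer C i.+1))%E.
Proof.
move=> lt_ik le_k; apply/bigmin_geP; split=> [|s bp]; first exact: bigmin_le_id.
apply: (@bigmin_inf _ _ _ _ s) => //.
apply: (@bigmin_inf_seq _ _ _ _ _ (top_layer C i.+1 s)) => //.
by rewrite /top_layer /= -(nth_take _ lt_ik) mem_nth // size_takel.
Qed.

Lemma P5_top_layer k i : 0 < B -> top_layers_condition C k -> i < k ->
  P5 C (top_layer C i.+1).
Proof.
move=> B_gt0 [k_gt0 le_k no1 lt_prio] lt_ik.
have lt_i s : i < size (C s) := leq_trans lt_ik (le_k s).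
split; last first.
  apply: le_lt_trans (lt_le_trans lt_prio (highest_BP_prio_layer lt_ik le_k)).
  have -> : lowest_stack_prio (remove_above C (top_layer C i.+1))
            = lowest_stack_prio (fun s => drop i (C s)).
    by apply: eq_bigr => s _; rewrite /remove_above index_top_layer.
  by apply: lowest_stack_prio_drop; rewrite -ltnS prednK.
have /existsP[t t1] : [exists s, 1 \in C s] by rewrite -mem_config.
exists t, 1.
  rewrite /below index_top_layer //.
  move: t1; rewrite -{1}(cat_take_drop k (C t)) mem_cat (negPf (no1 t)) /=.
  by rewrite -(subnK lt_ik) -drop_drop; apply: mem_drop.
apply: lt_bigmin => [|s _]; first exact: ltry.
rewrite /prio lte_fin ltz_nat ltn_neqAle; apply/andP; split.
  apply: contraNneq (no1 s) => ->.
  by rewrite /top_layer /= -(nth_take _ lt_ik) mem_nth // size_takel.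
have : [exists r, top_layer C i.+1 s \in C r].
  by apply/existsP; exists s; apply: top_layer_mem.
by rewrite -mem_config => /andP[].
Qed.

End Configurations.

Theorem corollary2 (S B : nat) (C : config S)
    (B_gt0 : 0 < B) (C_config : is_config B C)
    (C_blocked : ~~ directly_retrievable C) :
  (forall k : nat, top_layers_condition C k ->
     property6_condition C (fun i : 'I_k => top_layer C i.+1)) /\
  (property6 B C -> property3 B C).
Proof.
have layers k : top_layers_condition C k ->
    property6_condition C (fun i : 'I_k => top_layer C i.+1).
  move=> top_k; have [_ le_k _ _] := top_k.
  have lt_size (i : 'I_k) s : i < size (C s) := leq_trans (ltn_ord i) (le_k s).
  split=> [i s|i j ne_ij s t|i]; first exact: top_layer_mem.
    exact: (top_layer_neq C_config).
  exact: (P5_top_layer C_config B_gt0 top_k).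
split=> // prop6 k top_k ms sol [|i] //= lt_ik.
have [vl _ p5] := layers k top_k.
have /prop6/(_ ms sol) :
    property6_condition C (fun _ : 'I_1 => top_layer C i.+1).
  split=> [_|j j'|_]; first exact: (vl (Ordinal lt_ik)).
    by rewrite !ord1.
  exact: (p5 (Ordinal lt_ik)).
rewrite -has_count => /hasP[b b_moved /existsP[_ /existsP[s /eqP b_eq]]].
by exists s; rewrite -b_eq.
Qed.
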